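(* Let $n \ge 1$ and let $f : \mathbb{R}^n \to \mathbb{R}$ be a spline, i.e., a continuous function for which there is a hyperplane partition $\{\Pi_\theta : \theta \in \Theta_b\}$ of $\mathbb{R}^n$ such that on every nonempty piece $\Pi_\theta$ the function $f$ coincides with a polynomial $g_\theta \in \mathbb{R}[x_1,\dots,x_n]$. Then $f$ is max-definable.
   Context: Hyperplane partition: for $b \in \mathbb{N}$ let $\Theta_b$ be the set of all maps $\theta : \{1,\dots,b\} \to \{1,0,-1\}$. Let $\pi_1,\dots,\pi_b \in \mathbb{R}[x_1,\dots,x_n]$ be polynomials of degree one. For $\theta \in \Theta_b$ put $\Pi_\theta := \{x \in \mathbb{R}^n : \operatorname{sgn}(\pi_i(x)) = \theta(i),\ i = 1,\dots,b\}$, where $\operatorname{sgn}$ takes values in $\{1,0,-1\}$. The collection $\{\Pi_\theta : \theta \in \Theta_b\}$ is the hyperplane partition of $\mathbb{R}^n$ induced by $\pi_1,\dots,\pi_b$, and each $\Pi_\theta$ is called a piece. Max-definable: a function $\mathbb{R}^n \to \mathbb{R}$ is max-definable if it belongs to the smallest set of functions $\mathbb{R}^n \to \mathbb{R}$ that contains the coordinate functions $x_1,\dots,x_n$ and the real constants and is closed under the pointwise operations of addition, multiplication, maximum $(u,v) \mapsto \max(u,v)$, and multiplication by real scalars. *)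

(* Defs.v *)
From mathcomp Require Import all_boot all_order all_algebra.
From mathcomp Require Import all_classical all_reals all_analysis.
(* The notations of mpoly clash with those of MathComp-Analysis. *)
From mathcomp Require mpoly.
Import -(notations) mpoly.
Import Order.TTheory GRing.Theory Num.Theory.
Import numFieldNormedType.Exports.

Set Implicit Arguments.
Unset Strict Implicit.
Unset Printing Implicit Defensive.

Local Open Scope classical_set_scope.
Local Open Scope ring_scope.

Definition peval (R : realType) (n : nat) (p : mpoly n R)
    (x : 'rV[R]_n) : R :=
  meval (fun i => x ord0 i) p.

Definition Theta (b : nat) : set ('I_b -> int) :=
  [set theta | forall i, theta i \in [:: 1; 0; -1]].
Arguments Theta : clear implicits.

Definition piece (R : realType) (n b : nat) (pi_ : 'I_b -> mpoly n R)
    (theta : 'I_b -> int) : set 'rV[R]_n :=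
  [set x | forall i, sgz (peval (pi_ i) x) = theta i].

(* mmeasure mdeg (the library's msize) is the total degree plus one. *)
Definition degree_one (R : realType) (n : nat) (p : mpoly n R) : Prop :=
  mmeasure mdeg p = 2%N.

Definition spline (R : realType) (n : nat) (f : 'rV[R]_n -> R) : Prop :=
  continuous f /\
  exists (b : nat) (pi_ : 'I_b -> mpoly n R),
    (forall i, degree_one (pi_ i)) /\
    forall theta, Theta b theta -> piece pi_ theta !=set0 ->
      exists g : mpoly n R, forall x, piece pi_ theta x -> f x = peval g x.

Definition max_generators (R : realType) (n : nat) : set ('rV[R]_n -> R) :=
  [set f | (exists i : 'I_n, f = (fun x : 'rV[R]_n => x ord0 i))
           \/ (exists c : R, f = cst c)].

Definition max_closed (R : realType) (n : nat)
    (A : set ('rV[R]_n -> R)) : Prop :=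
  [/\ forall u v, A u -> A v -> A (u \+ v),
      forall u v, A u -> A v -> A (u \* v),
      forall u v, A u -> A v -> A (u \max v)
    & forall (c : R) u, A u -> A (c \*: u)].

Definition max_definable (R : realType) (n : nat) : set ('rV[R]_n -> R) :=
  smallest (@max_closed R n) (@max_generators R n).

(* Main.v *)
Require Import Defs.
From mathcomp Require Import all_boot all_order all_algebra.
From mathcomp Require Import all_classical all_reals all_analysis.
From mathcomp Require mpoly.
From mathcomp Require Import ring lra.
Import -(notations) mpoly.
Import Order.TTheory GRing.Theory Num.Theory.
Import numFieldNormedType.Exports.

Set Implicit Arguments.
Unset Strict Implicit.
Unset Printing Implicit Defensive.

Local Open Scope classical_set_scope.
Local Open Scope ring_scope.

(** The claim reduces to pairs of closed pieces, as follows. Let [f]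
    agree with polynomials [g_i] on finitely many closed polyhedra [A_i]
    covering the space. If for all [i], [j] some max-definable [h_ij] equals
    [f] on [A_i] and is at most [f] on [A_j], then [f = max_i min_j h_ij],
    because [min_j h_ij] is at most [f] everywhere and equals [f] on [A_i]
    ([maxdef_glue]).

    To build [h_ij], put [p = g_i - g_j], which vanishes on the intersection of
    [A_i] and [A_j] since both polynomials equal [f] there. It suffices to find
    a max-definable [u] which vanishes on [A_i] and dominates [|p|] on [A_j],
    for then [h_ij = g_i - u] works. This is a Lojasiewicz inequality
    ([vanishing_bound]), and for polyhedra it follows from Hoffman's error
    bound ([hoffman]): if [x] in [A_j] violates the inequalities of [A_i] by at
    most [d], then some [y] in both polyhedra satisfies [|x - y| <= C * d].
    The maximal violation [d x] is max-definable, and max-definable functions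
    are Lipschitz with a max-definable constant [Q] ([maxdef_lipschitz]), so
    [|p x| = |p x - p y| <= C * d x * Q x]. When the polyhedra are disjoint,
    [C * d x >= 1] on [A_j], and [C * d x * |p x|] is the bound. Hoffman's
    bound is proved by Fourier-Motzkin elimination, keeping track of constants.

    The closed polyhedra are the nonempty pieces with their strict inequalities
    made weak; a nonempty piece is dense in its closed version, so [f] agrees
    with the same polynomial there by continuity. *)

(** * Systems of affine inequalities and Hoffman's error bound *)

Section AffineForms.
Variables (R : realFieldType) (n : nat).
Implicit Types (s r q : 'rV[R]_n * R) (S : seq ('rV[R]_n * R)).
Implicit Types (x y : 'rV[R]_n) (k : 'I_n).

Definition aff_eval s x : R := s.2 + \sum_k s.1 ord0 k * x ord0 k.

Definition aff_comb (a : R) s (b : R) r : 'rV[R]_n * R :=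
  (a *: s.1 + b *: r.1, a * s.2 + b * r.2).

Definition coord_close (d : R) x y := forall k, `|x ord0 k - y ord0 k| <= d.

Definition feasible S x := forall s, s \in S -> 0 <= aff_eval s x.

(** A Hoffman error bound. The guard [C * d < 1] lets one statement cover
    infeasible systems as well: for those it says that some constraint is
    violated by at least [C^-1] at every point. *)
Definition error_bound S C := forall x d, 0 <= d ->
  (forall s, s \in S -> - d <= aff_eval s x) ->
  C * d < 1 -> exists2 y, feasible S y & coord_close (C * d) x y.

Lemma aff_eval_comb a s b r x :
  aff_eval (aff_comb a s b r) x = a * aff_eval s x + b * aff_eval r x.
Proof.
rewrite /aff_eval /= !mulrDr addrACA !mulr_sumr; congr (_ + _).
rewrite -big_split /=; apply: eq_bigr => k _.
by rewrite !mxE mulrDl !mulrA.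
Qed.

Lemma aff_eval_translate s x (t : R) k :
  aff_eval s (x + t *: delta_mx ord0 k) = aff_eval s x + t * s.1 ord0 k.
Proof.
rewrite /aff_eval -addrA; congr (_ + _).
rewrite (bigD1 k) //= [in RHS](bigD1 k) //= !mxE !eqxx mulr1 mulrDr.
rewrite -!addrA; congr (_ + _); rewrite addrC mulrC; congr (_ + _).
by apply: eq_bigr => j /negPf jk; rewrite !mxE jk mulr0 addr0.
Qed.

Lemma aff_eval_lipschitz s x y d : coord_close d x y ->
  `|aff_eval s x - aff_eval s y| <= (\sum_k `|s.1 ord0 k|) * d.
Proof.
move=> xy; rewrite /aff_eval opprD addrACA subrr add0r -sumrB mulr_suml.
apply: (le_trans (ler_norm_sum _ _ _)); apply: ler_sum => k _.
by rewrite -mulrBr normrM ler_wpM2l.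
Qed.

Lemma uniform_bound (T : eqType) (l : seq T) (F : T -> R) :
  exists2 M, 1 <= M & forall z, z \in l -> F z <= M.
Proof.
elim: l => [|z l [M M1 Ml]]; first by exists 1.
exists (Num.max M (F z)) => [|w]; first by rewrite le_max M1.
rewrite inE => /orP[/eqP->|/Ml wM]; first by rewrite le_max lexx orbT.
by rewrite le_max wM.
Qed.

(** Lower bounds [L] and upper bounds [U] that are pairwise compatible have a
    common solution, which can be taken as close to 0 as each bound
    separately requires. *)
Lemma interval_point (L U : seq R) d : 0 <= d ->
  {in L & U, forall l u, l <= u} ->
  {in L, forall l, l <= d} -> {in U, forall u, - d <= u} ->
  exists t, [/\ `|t| <= d, {in L, forall l, l <= t} & {in U, forall u, t <= u}].
Proof.
move=> d0 LU Ld Ud.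
suff [t [t1 t2 t3 t4]] : exists t, [/\ - d <= t, t <= d,
    {in L, forall l, l <= t} & {in U, forall u, t <= u}].
  by exists t; split=> //; rewrite ler_norml t1.
elim: L LU Ld => [|l L IH] LU Ld.
  by exists (- d); split=> //; lra.
have [a b aL bU|a aL|t [t1 t2 t3 t4]] := IH.
- by apply: LU => //; rewrite inE aL orbT.
- by apply: Ld; rewrite inE aL orbT.
exists (Num.max t l); split.
- by rewrite le_max t1.
- by rewrite ge_max t2 Ld // mem_head.
- move=> a; rewrite inE => /orP[/eqP->|/t3 aa]; rewrite le_max ?aa //.
  by rewrite lexx orbT.
- by move=> u uU; rewrite ge_max t4 //= LU // mem_head.
Qed.

(** One step of Fourier-Motzkin elimination of the coordinate [k]: a constraint
    with positive and one with negative slope are scaled to opposite slopes and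
    added. *)
Definition eliminate k S : seq ('rV[R]_n * R) :=
  [seq s : 'rV[R]_n * R <- S | s.1 ord0 k == 0] ++
  [seq aff_comb (s.1 ord0 k)^-1 s (- r.1 ord0 k)^-1 r |
     s : 'rV[R]_n * R <- [seq s : 'rV[R]_n * R <- S | 0 < s.1 ord0 k],
     r : 'rV[R]_n * R <- [seq r : 'rV[R]_n * R <- S | r.1 ord0 k < 0]].

Lemma mem_eliminate k S q : q \in eliminate k S ->
  (q \in S /\ q.1 ord0 k = 0) \/
  exists s r, [/\ s \in S, r \in S, 0 < s.1 ord0 k, r.1 ord0 k < 0 &
    q = aff_comb (s.1 ord0 k)^-1 s (- r.1 ord0 k)^-1 r].
Proof.
rewrite mem_cat => /orP[|/allpairsP[[s r] /= []]].
  by rewrite mem_filter => /andP[/eqP]; left.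
rewrite !mem_filter => /andP[? ?] /andP[? ?] ?; right.
by exists s, r; split.
Qed.

(** Each constraint of [S] bounds the step [t] along the coordinate [k] from
    one side. The constraints of [eliminate k S] say that these bounds are
    compatible, and the hypothesis on [d] that each one allows some [t] with
    [|t| <= d]. *)
Lemma feasible_eliminate k S x d : 0 <= d -> feasible (eliminate k S) x ->
  (forall s, s \in S -> - (d * `|s.1 ord0 k|) <= aff_eval s x) ->
  exists2 t, `|t| <= d & feasible S (x + t *: delta_mx ord0 k).
Proof.
move=> d0 Ex Sd.
pose P := [seq s : 'rV[R]_n * R <- S | 0 < s.1 ord0 k].
pose N := [seq s : 'rV[R]_n * R <- S | s.1 ord0 k < 0].
pose root s := - aff_eval s x / s.1 ord0 k.
have [|||t [td tP tN]] := @interval_point (map root P) (map root N) d d0.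
- move=> _ _ /mapP[s sP ->] /mapP[r rN ->].
  have := Ex (aff_comb (s.1 ord0 k)^-1 s (- r.1 ord0 k)^-1 r).
  rewrite aff_eval_comb mem_cat (_ : _ \in [seq _ | _ <- _, _ <- _]).
    rewrite orbT => /(_ isT); rewrite /root invrN; lra.
  by apply/allpairsP; exists (s, r).
- move=> _ /mapP[s + ->]; rewrite mem_filter => /andP[s0 sS].
  have := Sd _ sS; rewrite ler_pdivrMr // gtr0_norm //; lra.
- move=> _ /mapP[s + ->]; rewrite mem_filter => /andP[s0 sS].
  have := Sd _ sS; rewrite ler_ndivlMr // ltr0_norm //; lra.
exists t => // s sS; rewrite aff_eval_translate.
have [s0|s0|s0] := ltgtP (s.1 ord0 k) 0.
- have : t <= root s by apply/tN/map_f; rewrite mem_filter s0.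
  rewrite ler_ndivlMr //; lra.
- have : root s <= t by apply/tP/map_f; rewrite mem_filter s0.
  rewrite ler_pdivrMr //; lra.
- rewrite s0 mulr0 addr0; apply: Ex.
  by rewrite mem_cat mem_filter s0 eqxx sS.
Qed.

(** The constraints of [eliminate k S] are violated at most [2 * M1] times as
    much as those of [S], so [x] is close to a point [y] feasible for the
    eliminated system; the violation of [S] at [y] is still of order [d] since
    affine forms are Lipschitz, and lifting [y] costs a move of that order. *)
Lemma error_bound_eliminate k S C : 0 <= C -> error_bound (eliminate k S) C ->
  exists2 C', 0 <= C' & error_bound S C'.
Proof.
move=> C0 HC.
have [M1 M11 HM1] := uniform_bound S (fun s => `|s.1 ord0 k|^-1).
have [M2 M21 HM2] := uniform_bound S (fun s => \sum_j `|s.1 ord0 j|).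
pose E := C * (2 * M1).
have E0 : 0 <= E by rewrite !mulr_ge0 //; lra.
have M0 : 0 <= M1 * (1 + M2 * E).
  by rewrite mulr_ge0 ?addr_ge0 ?mulr_ge0 //; lra.
exists (E + M1 * (1 + M2 * E)) => [|x d d0 Sx Cd]; first exact: addr_ge0.
have Ed : C * (2 * M1 * d) = E * d by rewrite /E !mulrA.
have [|q||y Ey xy] := HC x (2 * M1 * d).
- by rewrite !mulr_ge0 //; lra.
- move=> /mem_eliminate[[qS _]|[s [r [sS rS s0 r0 ->]]]].
    apply: le_trans (Sx _ qS); rewrite lerN2 ler_peMl //; lra.
  rewrite aff_eval_comb.
  have := HM1 _ sS; have := HM1 _ rS; rewrite (gtr0_norm s0) (ltr0_norm r0).
  have := Sx _ sS; have := Sx _ rS.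
  have : 0 < (s.1 ord0 k)^-1 by rewrite invr_gt0.
  have : 0 < (- r.1 ord0 k)^-1 by rewrite invr_gt0 oppr_gt0.
  move: (_^-1) (_^-1) (aff_eval _ _) (aff_eval _ _).
  move=> a b u v a0 b0 du dv aM bM.
  have : - (M1 * d) <= a * u by nra.
  have : - (M1 * d) <= b * v by nra.
  lra.
- rewrite Ed; apply: le_lt_trans Cd; rewrite mulrDl lerDl; exact: mulr_ge0.
rewrite {}Ed in xy.
have [||t td yt] := @feasible_eliminate k S y (M1 * (1 + M2 * E) * d) _ Ey.
- exact: mulr_ge0.
- move=> s sS.
  have [s0|s0] := eqVneq (s.1 ord0 k) 0.
    rewrite s0 normr0 mulr0 oppr0; apply: Ey.
    by rewrite mem_cat mem_filter s0 eqxx sS.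
  have := aff_eval_lipschitz s xy; rewrite ler_norml => /andP[_ xsy].
  have {}xsy : aff_eval s x - aff_eval s y <= M2 * (E * d).
    apply: (le_trans xsy); apply: ler_wpM2r; first exact: mulr_ge0.
    exact: HM2.
  have := Sx _ sS.
  have h : 0 < `|s.1 ord0 k| by rewrite normr_gt0.
  have : 1 <= M1 * `|s.1 ord0 k|.
    by rewrite -ler_pdivrMr // mul1r; exact: HM1.
  have : 0 <= (1 + M2 * E) * d.
    by rewrite mulr_ge0 // addr_ge0 // mulr_ge0 //; lra.
  move=> p0 aM sx.
  have : (1 + M2 * E) * d <= M1 * (1 + M2 * E) * d * `|s.1 ord0 k| by nra.
  lra.
exists (y + t *: delta_mx ord0 k) => // j.
rewrite !mxE eqxx /= opprD addrA mulrDl.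
apply: (le_trans (ler_normB _ _)); apply: lerD; first exact: xy.
apply: le_trans td; rewrite normrM ler_piMr //.
by case: (j == k); rewrite ?normr1 ?normr0.
Qed.

(** Hoffman's lemma, by eliminating the coordinates one after the other until
    only constant constraints remain. *)
Lemma hoffman S : exists2 C, 0 <= C & error_bound S C.
Proof.
suff H : forall m, (m <= n)%N -> forall S,
    (forall s, s \in S -> forall j : 'I_n, (m <= j)%N -> s.1 ord0 j = 0) ->
    exists2 C, 0 <= C & error_bound S C.
  by apply: (H n) => // s _ j; rewrite leqNgt ltn_ord.
elim=> [_|m IH mn] {}S Sm.
  (* No coordinate is left: an unsatisfied constant [s.2 < 0] forces
     [- s.2 <= d], which the choice of [C] makes incompatible with
     [C * d < 1]. *)
  have Sval s x : s \in S -> aff_eval s x = s.2.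
    move=> sS; rewrite /aff_eval big1 ?addr0 // => j _.
    by rewrite (Sm s sS) // mul0r.
  have [C C1 HC] := uniform_bound S (fun s => `|s.2|^-1).
  exists C => [|x d d0 Sx Cd]; first lra.
  exists x => [s sS|j]; last by rewrite subrr normr0 mulr_ge0 //; lra.
  rewrite (Sval _ _ sS); have := Sx _ sS; rewrite (Sval _ _ sS) => sd.
  rewrite leNgt; apply/negP => s0.
  have := HC _ sS; rewrite ltr0_norm // -div1r ler_pdivrMr ?oppr_gt0 //; nra.
pose k := Ordinal mn.
have [C C0 HC] : exists2 C, 0 <= C & error_bound (eliminate k S) C.
  apply: IH => [|q /mem_eliminate qS j]; first exact: ltnW.
  rewrite leq_eqVlt => /orP[/eqP mj|mj].
    have -> : j = k by apply/val_inj/esym.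
    case: qS => [[_ ->//]|[s [r [_ _ s0 r0 ->]]]] /=.
    by rewrite !mxE invrN mulNr !mulVf ?subrr // ?(gt_eqF s0) ?(lt_eqF r0).
  case: qS => [[qS _]|[s [r [/Sm sS /Sm rS _ _ ->]]]] /=; first exact: Sm.
  by rewrite !mxE (sS j) // (rS j) // !mulr0 addr0.
exact: error_bound_eliminate C0 HC.
Qed.

End AffineForms.

(** * Max-definable functions *)

Section MaxDefinable.
Variables (R : realType) (n : nat).
Implicit Types (u v p f g : 'rV[R]_n -> R) (x y : 'rV[R]_n).
Local Notation maxdef := (@max_definable R n).

Lemma maxdef_closed : @max_closed R n maxdef.
Proof.
split=> [u v mu mv|u v mu mv|u v mu mv|c u mu] A AA;
  have [[AD AM AX AZ] _] : max_closed A /\ max_generators (n:=n) `<=` A := AA.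
- exact: AD (mu _ AA) (mv _ AA).
- exact: AM (mu _ AA) (mv _ AA).
- exact: AX (mu _ AA) (mv _ AA).
- exact: AZ (mu _ AA).
Qed.

Lemma maxdef_coord i : maxdef (fun x => x ord0 i).
Proof.
have H : @max_generators R n `<=` maxdef by exact: sub_smallest.
by apply: H; left; exists i.
Qed.

Lemma maxdef_cst c : maxdef (fun=> c).
Proof.
have H : @max_generators R n `<=` maxdef by exact: sub_smallest.
by apply: H; right; exists c.
Qed.

Lemma maxdefD u v : maxdef u -> maxdef v -> maxdef (fun x => u x + v x).
Proof. by case: maxdef_closed => H _ _ _; exact: H. Qed.

Lemma maxdefM u v : maxdef u -> maxdef v -> maxdef (fun x => u x * v x).
Proof. by case: maxdef_closed => _ H _ _; exact: H. Qed.

Lemma maxdef_max u v :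
  maxdef u -> maxdef v -> maxdef (fun x => Num.max (u x) (v x)).
Proof. by case: maxdef_closed => _ _ H _; exact: H. Qed.

Lemma maxdefZ c u : maxdef u -> maxdef (fun x => c * u x).
Proof. by case: maxdef_closed => _ _ _ H; exact: H. Qed.

Lemma maxdefB u v : maxdef u -> maxdef v -> maxdef (fun x => u x - v x).
Proof.
move=> mu mv; have := maxdefD mu (maxdefZ (-1) mv).
by congr maxdef; apply/funext => x; rewrite mulN1r.
Qed.

Lemma maxdef_min u v :
  maxdef u -> maxdef v -> maxdef (fun x => Num.min (u x) (v x)).
Proof.
move=> mu mv; have := maxdefB (maxdefD mu mv) (maxdef_max mu mv).
by congr maxdef; apply/funext => x; rewrite -(addr_max_min (u x)) addrC addKr.
Qed.

Lemma maxdef_norm u : maxdef u -> maxdef (fun x => `|u x|).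
Proof.
move=> mu; have := maxdef_max mu (maxdefZ (-1) mu).
by congr maxdef; apply/funext => x; rewrite mulN1r maxrN.
Qed.

Lemma maxdef_sum (I : Type) (r : seq I) (F : I -> 'rV[R]_n -> R) :
  (forall i, maxdef (F i)) -> maxdef (fun x => \sum_(i <- r) F i x).
Proof.
move=> mF; elim: r => [|i r IH].
  by have := maxdef_cst 0; congr maxdef; apply/funext => x; rewrite big_nil.
have := maxdefD (mF i) IH.
by congr maxdef; apply/funext => x; rewrite big_cons.
Qed.

Lemma maxdef_exp u k : maxdef u -> maxdef (fun x => u x ^+ k).
Proof.
move=> mu; elim: k => [|k IH]; first exact: maxdef_cst 1.
have := maxdefM mu IH.
by congr maxdef; apply/funext => x; rewrite exprS.
Qed.

Lemma maxdef_prod (I : Type) (r : seq I) (F : I -> 'rV[R]_n -> R) :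
  (forall i, maxdef (F i)) -> maxdef (fun x => \prod_(i <- r) F i x).
Proof.
move=> mF; elim: r => [|i r IH].
  by have := maxdef_cst 1; congr maxdef; apply/funext => x; rewrite big_nil.
have := maxdefM (mF i) IH.
by congr maxdef; apply/funext => x; rewrite big_cons.
Qed.

Lemma maxdef_peval (g : mpoly n R) : maxdef (peval g).
Proof.
have : maxdef (fun x =>
    \sum_(m <- msupp g) (mcoeff m g * \prod_i x ord0 i ^+ m i)).
  apply: maxdef_sum => m; apply: maxdefZ; apply: maxdef_prod => i.
  exact: maxdef_exp (maxdef_coord i).
by congr maxdef; apply/funext => x; rewrite /peval mevalE.
Qed.

Lemma maxdef_aff_eval s : maxdef (aff_eval s).
Proof.
apply: maxdefD; first exact: maxdef_cst.
apply: maxdef_sum => k; exact: maxdefZ (maxdef_coord k).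
Qed.

Lemma maxdef_ind (P : ('rV[R]_n -> R) -> Prop) :
  (forall i, P (fun x => x ord0 i)) -> (forall c, P (fun=> c)) ->
  (forall u v, maxdef u -> maxdef v -> P u -> P v -> P (fun x => u x + v x)) ->
  (forall u v, maxdef u -> maxdef v -> P u -> P v -> P (fun x => u x * v x)) ->
  (forall u v, maxdef u -> maxdef v -> P u -> P v ->
     P (fun x => Num.max (u x) (v x))) ->
  forall f, maxdef f -> P f.
Proof.
move=> Pco Pc PD PM Pm.
suff Q : maxdef `<=` (maxdef `&` P) by move=> f /Q[].
apply: smallest_sub; last first.
  move=> f [[i ->]|[c ->]]; split=> //.
  - exact: maxdef_coord.
  - exact: maxdef_cst.
  - exact: Pc.
split=> [u v [mu Pu] [mv Pv]|u v [mu Pu] [mv Pv]|u v [mu Pu] [mv Pv]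
  |c u [mu Pu]].
- by split; [exact: maxdefD|exact: PD].
- by split; [exact: maxdefM|exact: PM].
- by split; [exact: maxdef_max|exact: Pm].
- split; first exact: maxdefZ.
  exact: PM (maxdef_cst c) mu (Pc c) Pu.
Qed.

Lemma maxdef_continuous f : maxdef f -> continuous f.
Proof.
apply: (maxdef_ind (P := fun u => continuous u)) =>
  [i|c|u v _ _ cu cv|u v _ _ cu cv|u v _ _ cu cv] x.
- exact: coord_continuous.
- exact: cst_continuous.
- exact: (continuousD (cu x) (cv x)).
- exact: (continuousM (cu x) (cv x)).
- exact: (continuous_max (cu x) (cv x)).
Qed.

(** Difference quotients are bounded by induction on the construction of [p].
    For a product, [p q] at [x] and [y] is compared through [p x * q y], and
    [q y] has to be bounded by a function of [x] alone; this is possible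
    because the distance to [y] is itself at most the max-definable [v x]. *)
Lemma maxdef_lipschitz v : maxdef v -> (forall x, 0 <= v x) ->
  forall p, maxdef p -> exists Q, [/\ maxdef Q, forall x, 0 <= Q x &
    forall x y, coord_close (v x) x y -> `|p x - p y| <= v x * Q x].
Proof.
move=> mv v0; apply: maxdef_ind.
- move=> i; exists (fun=> 1); split=> [|//|x y xy]; first exact: maxdef_cst.
  by rewrite mulr1; exact: xy.
- move=> c; exists (fun=> 0); split=> [|//|x y xy]; first exact: maxdef_cst.
  by rewrite subrr normr0 mulr0.
- move=> p q mp mq [P [mP P0 HP]] [Q [mQ Q0 HQ]].
  exists (fun x => P x + Q x); split=> [|x|x y xy]; first exact: maxdefD.
    exact: addr_ge0.
  rewrite opprD addrACA mulrDr (le_trans (ler_normD _ _)) //.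
  by apply: lerD; [exact: HP|exact: HQ].
- move=> p q mp mq [P [mP P0 HP]] [Q [mQ Q0 HQ]].
  exists (fun x => `|p x| * Q x + P x * (`|q x| + v x * Q x)).
  split=> [|x|x y xy].
  + have mn := maxdef_norm.
    by do ?[exact: mn|apply: maxdefD|apply: maxdefM].
  + by rewrite addr_ge0 // mulr_ge0 // addr_ge0 // mulr_ge0.
  have pq : p x * q x - p y * q y = p x * (q x - q y) + (p x - p y) * q y.
    by ring.
  have := HP x y xy; have := HQ x y xy => hq hp.
  have qy : `|q y| <= `|q x| + v x * Q x.
    have -> : q y = q x - (q x - q y) by ring.
    by rewrite (le_trans (ler_normB _ _)) // lerD2l.
  rewrite pq (le_trans (ler_normD _ _)) // !normrM mulrDr.
  apply: lerD; first by rewrite mulrCA ler_wpM2l.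
  by rewrite mulrA ler_pM.
- move=> p q mp mq [P [mP P0 HP]] [Q [mQ Q0 HQ]].
  exists (fun x => P x + Q x); split=> [|x|x y xy]; first exact: maxdefD.
    exact: addr_ge0.
  have := HP x y xy; have := HQ x y xy; rewrite !ler_norml mulrDr.
  have := mulr_ge0 (v0 x) (P0 x); have := mulr_ge0 (v0 x) (Q0 x).
  by case: (leP (p x) (q x)); case: (leP (p y) (q y)); lra.
Qed.

Lemma exists_violation (S : seq ('rV[R]_n * R)) : exists d, [/\ maxdef d,
  forall x, 0 <= d x, forall x, feasible S x -> d x = 0 &
  forall x s, s \in S -> - d x <= aff_eval s x].
Proof.
elim: S => [|s S [d [md d0 dS Sd]]].
  by exists (fun=> 0); split=> //; exact: maxdef_cst.
exists (fun x => Num.max (d x) (- 1 * aff_eval s x)); split.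
- exact: maxdef_max md (maxdefZ (-1) (maxdef_aff_eval s)).
- by move=> x; rewrite le_max d0.
- move=> x Fx; rewrite dS => [|r rS].
    rewrite mulN1r; apply/max_idPl; rewrite oppr_le0; apply: Fx.
    exact: mem_head.
  by apply: Fx; rewrite inE rS orbT.
- move=> x r; rewrite inE mulN1r lerNl le_max => /orP[/eqP->|/Sd h].
    by rewrite lexx orbT.
  by rewrite lerNl h.
Qed.

(** A Lojasiewicz inequality: a max-definable function vanishing on the
    intersection of two polyhedra is controlled on the second one by the
    violation of the inequalities of the first one. *)
Lemma vanishing_bound (A B : seq ('rV[R]_n * R)) p : maxdef p ->
  (forall x, feasible A x -> feasible B x -> p x = 0) ->
  exists u, [/\ maxdef u, forall x, feasible A x -> u x = 0 &
    forall x, feasible B x -> `|p x| <= u x].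
Proof.
move=> mp pAB.
have [C C0 HC] := hoffman (A ++ B).
have [d [md d0 dA Ad]] := exists_violation A.
have mCd := maxdefZ C md.
have Cd0 x : 0 <= C * d x by rewrite mulr_ge0.
have [Q [mQ Q0 HQ]] := maxdef_lipschitz mCd Cd0 mp.
exists (fun x => C * d x * (Q x + `|p x|)); split.
- apply: maxdefM => //; apply: maxdefD => //; exact: maxdef_norm.
- by move=> x Ax; rewrite dA // mulr0 mul0r.
move=> x Bx; have [Cd1|Cd1] := leP 1 (C * d x).
  (* Far from [A]: the summand [|p x|] suffices; it also settles the case of
     disjoint polyhedra. *)
  have := Q0 x; have := normr_ge0 (p x); move: `|p x| => a; nra.
have [s|y ABy xy] := HC x (d x) (d0 x) _ Cd1.
  by rewrite mem_cat => /orP[/Ad //|/Bx]; apply: le_trans; rewrite oppr_le0.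
have py : p y = 0.
  by apply: pAB => s sS; apply: ABy; rewrite mem_cat sS ?orbT.
have := HQ x y xy; rewrite py subr0 => h.
by rewrite (le_trans h) // ler_wpM2l // lerDl.
Qed.

(** * Gluing max-definable functions along a polyhedral cover *)

(** [f] is the maximum over [i] of the minimum over [j] of functions that agree
    with [f] on the [i]-th polyhedron and stay below it on the [j]-th one. *)
Lemma maxdef_glue (I : finType) (S : I -> seq ('rV[R]_n * R))
    (g : I -> 'rV[R]_n -> R) f :
  (forall i, maxdef (g i)) ->
  (forall i x, feasible (S i) x -> f x = g i x) ->
  (forall x, exists i, feasible (S i) x) -> maxdef f.
Proof.
move=> mg fg cover.
have sep i j : exists h, [/\ maxdef h, forall x, feasible (S i) x -> h x = f x &
    forall x, feasible (S j) x -> h x <= f x].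
  have [|u [mu uA uB]] :=
    vanishing_bound (A := S i) (B := S j) (maxdefB (mg i) (mg j)).
    by move=> x Ax Bx; rewrite -fg // -fg // subrr.
  exists (fun x => g i x - u x); split=> [|x Ax|x Bx]; first exact: maxdefB.
    by rewrite uA // subr0 -fg.
  rewrite (fg j) //; have := le_trans (ler_norm _) (uB x Bx); lra.
have minorant i : exists F, [/\ maxdef F, forall x, F x <= f x &
    forall x, feasible (S i) x -> F x = f x].
  suff [F [mF Ff FS]] : exists F, [/\ maxdef F,
      forall j, j \in enum I -> forall x, feasible (S j) x -> F x <= f x &
      forall x, feasible (S i) x -> F x = f x].
    exists F; split=> // x; have [j jx] := cover x.
    by apply: Ff jx; rewrite mem_enum.
  elim: (enum I) => [|j r [F [mF Fr Fi]]].
    by have [h [mh hi _]] := sep i i; exists h; split.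
  have [h [mh hi hj]] := sep i j.
  exists (fun x => Num.min (F x) (h x)); split; first exact: maxdef_min.
    move=> k; rewrite inE => /orP[/eqP->|kr] x kx.
      by rewrite ge_min hj ?orbT.
    by rewrite ge_min (Fr k).
  by move=> x ix; rewrite Fi // hi // minxx.
suff [F [mF Ff Feq]] : exists F, [/\ maxdef F, forall x, F x <= f x &
    forall j, j \in enum I -> forall x, feasible (S j) x -> F x = f x].
  suff -> : f = F by [].
  apply/funext => x; have [j jx] := cover x.
  by rewrite (Feq j) ?mem_enum.
elim: (enum I) => [|j r [F [mF Ff Fr]]].
  have [i _] := cover 0; have [F [mF Ff _]] := minorant i.
  by exists F; split.
have [G [mG Gf Gj]] := minorant j.
exists (fun x => Num.max (F x) (G x)); split; first exact: maxdef_max.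
  by move=> x; rewrite ge_max Ff Gf.
move=> k; rewrite inE => /orP[/eqP->|kr] x kx; apply/le_anti.
  by rewrite ge_max Ff Gf le_max Gj // lexx orbT.
by rewrite ge_max Ff Gf le_max (Fr k) // lexx.
Qed.

End MaxDefinable.

(** * Splines *)

Section Splines.
Variables (R : realType) (n : nat).
Implicit Types (f g : 'rV[R]_n -> R) (x y z : 'rV[R]_n).

Lemma degree_one_affine (q : mpoly n R) : degree_one q ->
  exists s : 'rV[R]_n * R, forall x, peval q x = aff_eval s x.
Proof.
move=> q1.
suff H : forall l : seq (multinom n), (forall m, m \in l -> (mdeg m <= 1)%N) ->
    exists s : 'rV[R]_n * R, forall x,
      \sum_(m <- l) mcoeff m q * \prod_i x ord0 i ^+ m i = aff_eval s x.
  have [|s sE] := H (msupp q).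
    by move=> m /msize_mdeg_lt; rewrite q1 ltnS.
  by exists s => x; rewrite /peval mevalE sE.
elim=> [|m l IH] Hl.
  exists (0, 0) => x; rewrite big_nil /aff_eval big1 ?addr0 // => k _.
  by rewrite mxE mul0r.
have [|s sE] := IH; first by move=> k kl; apply: Hl; rewrite inE kl orbT.
have [r rE] : exists r : 'rV[R]_n * R, forall x,
    \prod_i x ord0 i ^+ m i = aff_eval r x.
  have := Hl m (mem_head _ _); rewrite leq_eqVlt ltnS leqn0.
  move=> /orP[/mdeg1P[i /eqP->]|].
    exists (delta_mx ord0 i, 0) => x.
    rewrite -mevalX mevalXU /aff_eval add0r (bigD1 i) //= big1 => [|k ki].
      by rewrite mxE !eqxx mul1r addr0.
    by rewrite mxE eqxx /= (negPf ki) mul0r.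
  rewrite mdeg_eq0 => /eqP->; exists (0, 1) => x.
  rewrite /aff_eval [X in _ + X]big1 ?addr0 => [|k _]; last first.
    by rewrite mxE mul0r.
  by rewrite big1 // => k _; rewrite mnm0E expr0.
exists (aff_comb (mcoeff m q) r 1 s) => x.
by rewrite big_cons sE rE aff_eval_comb mul1r.
Qed.

Lemma eq_on_segment_start f g x z : continuous f -> continuous g ->
  (forall t : R, 0 < t <= 1 -> f (x + t *: (z - x)) = g (x + t *: (z - x))) ->
  f x = g x.
Proof.
move=> cf cg fg.
pose l (t : R) : 'rV[R]_n := x + t *: (z - x).
have cl : {for 0, continuous l}.
  apply: continuousD; first exact: cst_continuous.
  exact: scalel_continuous.
have l0 : l 0 = x by rewrite /l scale0r addr0.
have cc (h : 'rV[R]_n -> R) : continuous h -> h (l t) @[t --> 0^'+] --> h x.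
  move=> ch; apply: cvg_within_filter.
  rewrite -[X in _ --> h X]l0.
  exact: (continuous_comp cl (ch _)).
apply: (cvg_unique (@Rhausdorff R) (F := f (l t) @[t --> 0^'+])).
  exact: cc.
apply: cvg_trans (cc g cg); apply: near_eq_cvg.
near=> t; apply/esym/fg; apply/andP; split; near: t.
  exact: nbhs_right_gt.
exact: nbhs_right_le.
Unshelve. all: by end_near. Qed.

(** The weak inequalities [theta i * s i >= 0], a vanishing [theta i]
    contributing both [s i >= 0] and [- s i >= 0]. *)
Definition closed_piece b (s : 'I_b -> 'rV[R]_n * R) (theta : 'I_b -> int) :
    seq ('rV[R]_n * R) :=
  [seq s i | i <- enum 'I_b & 0 <= theta i] ++
  [seq aff_comb (-1) (s i) 0 (s i) | i <- enum 'I_b & theta i <= 0].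

Lemma feasible_closed_pieceP b (pi_ : 'I_b -> mpoly n R) s theta x :
  (forall i x, peval (pi_ i) x = aff_eval (s i) x) ->
  feasible (closed_piece s theta) x <->
  forall i, (0 <= theta i -> 0 <= peval (pi_ i) x) /\
            (theta i <= 0 -> peval (pi_ i) x <= 0).
Proof.
move=> sE; split=> [Fx i|H q].
  split=> ti; rewrite sE.
    apply: Fx; rewrite mem_cat; apply/orP; left.
    by apply/mapP; exists i; rewrite // mem_filter ti mem_enum.
  have := Fx (aff_comb (-1) (s i) 0 (s i)).
  rewrite aff_eval_comb mul0r addr0 mulN1r oppr_ge0; apply.
  rewrite mem_cat; apply/orP; right.
  by apply/mapP; exists i; rewrite // mem_filter ti mem_enum.
rewrite mem_cat => /orP[] /mapP[i + ->]; rewrite mem_filter => /andP[ti _].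
  by rewrite -sE; have [/(_ ti)] := H i.
rewrite aff_eval_comb mul0r addr0 mulN1r oppr_ge0 -sE.
by have [_ /(_ ti)] := H i.
Qed.

Lemma piece_sub_closed b (pi_ : 'I_b -> mpoly n R) s theta x :
  (forall i x, peval (pi_ i) x = aff_eval (s i) x) ->
  piece pi_ theta x -> feasible (closed_piece s theta) x.
Proof.
move=> sE Px; apply/(feasible_closed_pieceP theta x sE) => i.
by rewrite -(Px i) sgz_ge0 sgz_le0.
Qed.

(** A nonempty piece is convex and its closed version lies in its closure: a
    strict sign at [z] and the matching weak sign at [x] give a strict sign on
    the half-open segment. *)
Lemma segment_piece b (pi_ : 'I_b -> mpoly n R) s theta x z (t : R) :
  (forall i x, peval (pi_ i) x = aff_eval (s i) x) ->
  feasible (closed_piece s theta) x -> piece pi_ theta z -> 0 < t <= 1 ->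
  piece pi_ theta (x + t *: (z - x)).
Proof.
move=> sE /(feasible_closed_pieceP theta x sE) Fx Pz /andP[t0 t1] i.
have -> : peval (pi_ i) (x + t *: (z - x)) =
    (1 - t) * peval (pi_ i) x + t * peval (pi_ i) z.
  rewrite !sE /aff_eval !mulrDr addrACA -mulrDl subrK mul1r; congr (_ + _).
  rewrite !mulr_sumr -big_split; apply: eq_bigr => k _; rewrite !mxE /=; ring.
have [] := Fx i; rewrite -(Pz i) sgz_ge0 sgz_le0.
move: (peval _ x) (peval _ z) => a c; have [c0|c0|->] := ltgtP c 0.
- by move=> _ /(_ isT) a0; rewrite !ltr0_sgz //; nra.
- by move=> /(_ isT) a0 _; rewrite !gtr0_sgz //; nra.
- move=> /(_ isT) a0 /(_ isT) a1; have -> : a = 0 by apply/le_anti/andP.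
  by rewrite !mulr0 addr0.
Qed.

End Splines.

Theorem theorem3p4 (R : realType) (n : nat) (hn : (1 <= n)%N)
    (f : 'rV[R]_n -> R) (hf : spline f) : max_definable f.
Proof.
case: hf => cf [b [pi_ [deg_pi fpi]]].
have [s sE] : exists s : 'I_b -> 'rV[R]_n * R,
    forall i x, peval (pi_ i) x = aff_eval (s i) x.
  by have [s sP] := choice (fun i => degree_one_affine (deg_pi i)); exists s.
(* Signs are coded by ['I_3], shifted by one, so that the nonempty pieces are
   indexed by a finite type. *)
pose sign (sg : {ffun 'I_b -> 'I_3}) (i : 'I_b) : int := (sg i)%:Z - 1.
pose J := {sg : {ffun 'I_b -> 'I_3} | `[< piece pi_ (sign sg) !=set0 >]}.
have sign_Theta sg : Theta b (sign sg).
  by move=> i; rewrite /sign; case: (sg i) => [[|[|[|]]]].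
have /choice[g gP] : forall j : J, exists q : mpoly n R,
    forall x, piece pi_ (sign (val j)) x -> f x = peval q x.
  by move=> j; apply: fpi => //; apply/asboolP/(valP j).
apply: (@maxdef_glue _ _ J (fun j => closed_piece s (sign (val j)))
  (fun j => peval (g j))) => [j|j x Fx|x].
- exact: maxdef_peval.
- have /asboolP[z Pz] := valP j.
  apply: (eq_on_segment_start (z := z)) => //.
    exact: maxdef_continuous (maxdef_peval _).
  by move=> t t01; apply: gP; exact: (segment_piece sE).
- pose sg : {ffun 'I_b -> 'I_3} :=
    [ffun i => inord (absz (sgz (peval (pi_ i) x) + 1))].
  have Px : piece pi_ (sign sg) x.
    by move=> i; rewrite /sign ffunE; case: sgzP; rewrite inordK.
  have ne : `[< piece pi_ (sign sg) !=set0 >] by apply/asboolP; exists x.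
  by exists (exist _ sg ne); exact: (piece_sub_closed sE).
Qed.
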